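(* Let $m\ge 1$, $n\ge 0$ and $h$ be integers. The number of partitions $\lambda$ of $n$ with an $h$-fixed hook in the $m$th column arising from a part of size $m$ (i.e. for which there is a row $i$ with $\lambda_i=m$ and $h_{i,m}(\lambda)=i+h$) equals the number of partitions of $n-mh$ in which $m$ appears as a part exactly once, there are no parts of sizes $m+1,m+2,\ldots,2m-1$, and there are at least $-h$ parts of size at least $2m$.
   Context: For a partition $\lambda=(\lambda_1\ge\lambda_2\ge\cdots)$ with conjugate $\lambda'$, the hook length of the cell $(i,j)$ (with $j\le\lambda_i$) of its Young diagram is $h_{i,j}(\lambda)=\lambda_i+\lambda'_j-i-j+1$. For an integer $h$, an $h$-fixed hook in the $m$th column is a row index $i$ with $\lambda_i\ge m$ and $h_{i,m}(\lambda)=i+h$; it ''arises from a part of size $k$'' if $\lambda_i=k$. *)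

(* Defs.v *)
From HB Require Import structures.
From mathcomp Require Import all_boot all_order all_algebra.

Set Implicit Arguments.
Unset Strict Implicit.
Unset Printing Implicit Defensive.

Import Order.TTheory GRing.Theory Num.Theory.

Local Open Scope nat_scope.

Definition is_part (s : seq nat) : bool := sorted geq s && (0 \notin s).

(* The weight is an integer because n - m h may be negative, in which case
   [intpart] is empty. *)
Record intpart (N : int) : Type := IntPart {
  parts :> seq nat;
  _ : is_part parts && ((sumn parts)%:Z == N)%R
}.

HB.instance Definition _ N := [isSub for @parts N].
HB.instance Definition _ N := [Countable of intpart N by <:].

Section Finiteness.

Variable N : int.

Lemma intpart_sumn (p : intpart N) : sumn p = `|N|%N.
Proof. by case: p => s /= /andP[_ /eqP <-]; rewrite absz_nat. Qed.

Lemma intpart_neq0 (p : intpart N) : 0 \notin (p : seq nat).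
Proof. by case: p => s /= /andP[/andP[]]. Qed.

Lemma leq_size_sumn (s : seq nat) : 0 \notin s -> size s <= sumn s.
Proof.
elim: s => //= k s IHs; rewrite inE negb_or => /andP[k0 /IHs le_s].
by rewrite -add1n leq_add // lt0n eq_sym.
Qed.

Lemma leq_mem_sumn (s : seq nat) k : k \in s -> k <= sumn s.
Proof.
elim: s => //= l s IHs; rewrite inE => /orP[/eqP->|/IHs le_k].
  exact: leq_addr.
exact: leq_trans le_k (leq_addl _ _).
Qed.

Definition bseq_of_intpart (p : intpart N) : `|N|.-bseq 'I_(`|N|.+1) :=
  insub_bseq _ [seq inord k | k <- p].

Definition intpart_of_bseq (b : `|N|.-bseq 'I_(`|N|.+1)) : option (intpart N) :=
  insub [seq val k | k <- b].

Lemma bseq_of_intpartK : pcancel bseq_of_intpart intpart_of_bseq.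
Proof.
move=> p; rewrite /intpart_of_bseq /bseq_of_intpart.
have le_size: size [seq (inord k : 'I_(`|N|.+1)) | k <- p] <= `|N|.
  by rewrite size_map -(intpart_sumn p) leq_size_sumn ?intpart_neq0.
rewrite /insub_bseq val_insubd le_size -map_comp map_id_in ?(valK p) //.
by move=> k kp /=; rewrite inordK // ltnS -(intpart_sumn p) leq_mem_sumn.
Qed.

End Finiteness.

HB.instance Definition _ (N : int) : isFinite (intpart N) :=
  PCanIsFinite (@bseq_of_intpartK N).

(* Rows and columns are numbered from 1. *)
Definition part (s : seq nat) (i : nat) : nat := nth 0 s i.-1.

Definition conj_part (s : seq nat) (j : nat) : nat := count (leq j) s.

Definition hook_length (s : seq nat) (i j : nat) : int :=
  ((part s i)%:Z + (conj_part s j)%:Z - i%:Z - j%:Z + 1)%R.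

Definition fixed_hook (h : int) (m : nat) (s : seq nat) (i : nat) : bool :=
  [&& 0 < i, m <= part s i & hook_length s i m == (i%:Z + h)%R].

Definition has_fixed_hook_from (h : int) (m k : nat) (s : seq nat) : bool :=
  has (fun i => fixed_hook h m s i && (part s i == k)) (iota 1 (size s)).

(* Main.v *)
(* Write lambda = (nu, m^f, mu), where the g parts of nu exceed m and those of
   mu are below m.  A row i = g + T + 1 with lambda_i = m carries an h-fixed
   hook in column m iff f = 2 T + 1 + g + h, and such a row exists iff T < f.
   Adding m to each part of nu and replacing the f parts m by T parts 2 m and a
   single part m changes the weight by - m h; the condition T < f becomes
   g + T >= - h, where g + T is the new number of parts of size at least 2 m. *)
Require Import Defs.
From mathcomp Require Import all_boot all_order all_algebra.
From mathcomp Require Import zify.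

Set Implicit Arguments.
Unset Strict Implicit.
Unset Printing Implicit Defensive.

Import Order.TTheory GRing.Theory Num.Theory.

Local Open Scope nat_scope.

(** * Partitions split at a value [c] *)

Lemma sumn_addn m s : sumn [seq m + k | k <- s] = sumn s + size s * m.
Proof. by elim: s => //= k s ->; rewrite mulSn; lia. Qed.

(** Comparisons between different blocks hold automatically, so only the order inside [a] and inside
    [b] matters. *)
Lemma sorted_geq_blocks c (a b : seq nat) f :
    all (ltn c) a -> all (gtn c) b ->
  sorted geq (a ++ nseq f c ++ b) = sorted geq a && sorted geq b.
Proof.
move=> ac bc; have geq_tr : transitive geq by move=> y x z /=; lia.
rewrite !(sorted_pairwise geq_tr) !pairwise_cat.
have -> : pairwise geq (nseq f c).
  by elim: f => //= f ->; rewrite andbT; apply/allP => k /nseqP[->] /=.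
have -> : allrel geq (nseq f c) b.
  by apply/allrelP => x y /nseqP[-> _] /(allP bc) /= /ltnW.
have -> // : allrel geq a (nseq f c ++ b).
apply/allrelP => x y /(allP ac) /= cx; rewrite mem_cat => /orP[].
  by move=> /nseqP[-> _]; apply: ltnW.
by move=> /(allP bc) /=; lia.
Qed.

(** Both sides are sorted and are permutations of each other, hence equal by antisymmetry. *)
Lemma sorted_geq_split c s : sorted geq s ->
  s = [seq k <- s | c < k] ++ nseq (count_mem c s) c ++ [seq k <- s | k < c].
Proof.
have geq_tr : transitive geq by move=> y x z /=; lia.
move=> s_sorted; apply: (@sorted_eq _ geq) => //.
- by move=> x y /=; lia.
- rewrite sorted_geq_blocks ?filter_all //.
  by rewrite !sorted_filter.
rewrite -(perm_filterC (ltn c) s) perm_cat2l.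
elim: s {s_sorted} => //= k s IHs.
case: (ltngtP c k) => [//|kc|<-] /=; last by rewrite perm_cons.
by rewrite perm_sym (perm_catCA _ [:: k]) perm_cons perm_sym.
Qed.

Section Blocks.

Variables (c f : nat) (a b : seq nat).
Hypotheses (ac : all (ltn c) a) (bc : all (gtn c) b).

Let s := a ++ nseq f c ++ b.

Lemma filter_gt_blocks : [seq k <- s | c < k] = a.
Proof.
rewrite !filter_cat filter_nseq ltnn /= (all_filterP ac).
rewrite (eq_in_filter (a2 := pred0)) ?filter_pred0 ?cats0 //.
by move=> k /(allP bc) /=; lia.
Qed.

Lemma filter_lt_blocks : [seq k <- s | k < c] = b.
Proof.
rewrite !filter_cat filter_nseq ltnn /= (all_filterP bc).
rewrite (eq_in_filter (a2 := pred0)) ?filter_pred0 //.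
by move=> k /(allP ac) /=; lia.
Qed.

Lemma count_mem_blocks : count_mem c s = f.
Proof.
rewrite !count_cat count_nseq /= eqxx mul1n.
rewrite (count_memPn _) ?(count_memPn _) ?addn0 //.
  by apply/negP => /(allP bc) /=; rewrite ltnn.
by apply/negP => /(allP ac) /=; rewrite ltnn.
Qed.

Lemma count_geq_blocks : count (leq c) s = size a + f.
Proof.
rewrite !count_cat count_nseq leqnn mul1n.
have -> : count (leq c) a = size a.
  by apply/eqP; rewrite -all_count; apply: sub_all ac => k /= /ltnW.
rewrite (eq_in_count (a2 := pred0)) ?count_pred0 ?addn0 //.
by move=> k /(allP bc) /=; lia.
Qed.

(** Positivity of [c] keeps it apart from the default value 0 returned beyond the last row. *)
Lemma nth_blocks i : 0 < c -> (nth 0 s i == c) = (size a <= i < size a + f).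
Proof.
move=> c0; rewrite !nth_cat nth_nseq size_nseq.
case: (ltnP i (size a)) => ia /=.
  by have /(allP ac) /= := mem_nth 0 ia; lia.
case: ltnP => iaf; first by rewrite eqxx; lia.
have [ib|ib] := ltnP (i - size a - f) (size b); last by rewrite nth_default; lia.
by have /(allP bc) /= := mem_nth 0 ib; lia.
Qed.

(** In row [size a + t + 1] the part is [c] and column [c] has length [size a + f], so the hook
    length is [f - t]; equating it with [size a + t + 1 + h] gives the relation. *)
Lemma fixed_hook_blocksP (h : int) : 0 < c ->
  reflect (exists2 t : nat, t < f & (f%:Z = t%:Z *+ 2 + 1 + (size a)%:Z + h)%R)
          (has_fixed_hook_from h c c s).
Proof.
move=> c0; apply: (iffP hasP) => [[i _]|[t tf fE]].
- move=> /andP[/and3P[i0 _ hookE] iE]; move: hookE iE.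
  rewrite /hook_length /part => /[swap] ieq; rewrite (eqP ieq).
  rewrite /conj_part count_geq_blocks => /eqP hookE.
  move: ieq; rewrite nth_blocks // => iE.
  (* The witness is the position of row [i] inside the block of parts [c], counted from 0. *)
  exists (i.-1 - size a); lia.
exists (size a + t).+1.
  by rewrite mem_iota !size_cat size_nseq; lia.
have pE : part s (size a + t).+1 = c.
  by apply/eqP; rewrite /part /= nth_blocks //; lia.
rewrite /fixed_hook /hook_length pE /conj_part count_geq_blocks leqnn eqxx /=.
by rewrite andbT; apply/eqP; lia.
Qed.

End Blocks.

(** [F] is injective on [P] because [G] undoes it there. The maps act on bare sequences, so no
    weight proofs are carried along. *)
Lemma leq_card_intpart (N M : int) (P Q : pred (seq nat))
    (F G : seq nat -> seq nat) :
    (forall s, is_part s -> ((sumn s)%:Z = N)%R -> P s ->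
      [/\ is_part (F s), ((sumn (F s))%:Z = M)%R, Q (F s) & G (F s) = s]) ->
  #|[set p : intpart N | P p]| <= #|[set p : intpart M | Q p]|.
Proof.
move=> FP; rewrite !cardE.
rewrite -(size_map (fun p : intpart N => F p)).
rewrite -(size_map (fun p : intpart M => p : seq nat)).
have partP (p : intpart N) : P p ->
    [/\ is_part (F p), ((sumn (F p))%:Z = M)%R, Q (F p) & G (F p) = p].
  by move=> Pp; apply: FP => //; case/andP: (valP p) => // _ /eqP.
apply: uniq_leq_size => [|s /mapP[p]].
  rewrite map_inj_in_uniq ?enum_uniq // => p q.
  rewrite !mem_enum !inE => /partP[_ _ _ pK] /partP[_ _ _ qK] Fpq.
  by apply: val_inj; rewrite /= -pK Fpq qK.
rewrite mem_enum inE => /partP[Fpart Fsum QF _] {s}->.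
have FM : is_part (F p) && ((sumn (F p))%:Z == M)%R by rewrite Fpart Fsum eqxx.
by apply/mapP; exists (IntPart FM); rewrite // mem_enum inE.
Qed.

(** * The two maps and their effect on block forms *)

Section Bijection.

Variables (m : nat) (h : int).
Hypothesis m_gt0 : 0 < m.

(** The multiplicity of [2 * m] solves f = 2 T + 1 + g + h for T; the absolute value and the halving
    are exact when the hook exists. *)
Definition double_above (s : seq nat) : seq nat :=
  let a := [seq k <- s | m < k] in
  [seq m + k | k <- a] ++
  nseq `|((count_mem m s)%:Z - 1 - (size a)%:Z - h)%R|./2 (2 * m) ++
  m :: [seq k <- s | k < m].

Definition halve_above (s : seq nat) : seq nat :=
  let a := [seq k <- s | 2 * m < k] in
  [seq k - m | k <- a] ++
  nseq `|((count_mem (2 * m) s)%:Z *+ 2 + 1 + (size a)%:Z + h)%R| m ++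
  [seq k <- s | k < m].

Definition gap_part (s : seq nat) : bool :=
  [&& count_mem m s == 1,
      all (fun k => ~~ (m + 1 <= k <= 2 * m - 1)) s
    & (- h <= (count (leq (2 * m)) s)%:Z)%R].

Section Canonical.

Variables (a b : seq nat) (f t : nat).
Hypotheses (am : all (ltn m) a) (bm : all (gtn m) b).
Hypothesis fE : (f%:Z = t%:Z *+ 2 + 1 + (size a)%:Z + h)%R.

(** The two maps exchange [s] and [s']. Under [fE], the hook condition on [s] and the gap condition
    on [s'] both amount to [t < f]. *)
Let s := a ++ nseq f m ++ b.
Let s' := [seq m + k | k <- a] ++ nseq t (2 * m) ++ m :: b.

Let am2 : all (ltn (2 * m)) [seq m + k | k <- a].
Proof. by rewrite all_map; apply: sub_all am => k /=; lia. Qed.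

Let bm2 : all (gtn (2 * m)) (m :: b).
Proof. by rewrite /=; apply/andP; split; [lia | apply: sub_all bm => k /=; lia]. Qed.

Let am1 : all (ltn m) ([seq m + k | k <- a] ++ nseq t (2 * m)).
Proof.
rewrite all_cat; apply/andP; split; first by apply: sub_all am2 => k /=; lia.
by apply/allP => k /nseqP[-> _] /=; lia.
Qed.

(** By definition [s'] is split at [2 * m]; this form splits it at [m], with multiplicity one. *)
Let s'E : s' = ([seq m + k | k <- a] ++ nseq t (2 * m)) ++ nseq 1 m ++ b.
Proof. by rewrite /s' -catA. Qed.

Lemma double_above_blocks : double_above s = s'.
Proof.
rewrite /double_above filter_gt_blocks // filter_lt_blocks // count_mem_blocks //.
(* By [fE] the number to be halved is [2 * t]. *)
by do 2![congr (_ ++ _)]; congr nseq; rewrite fE; lia.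
Qed.

Lemma halve_above_blocks : halve_above s' = s.
Proof.
rewrite /halve_above filter_gt_blocks // count_mem_blocks //.
rewrite {1}s'E filter_lt_blocks // size_map -fE absz_nat -map_comp.
by rewrite map_id_in // => k _ /=; rewrite addKn.
Qed.

Lemma is_part_double_blocks : is_part s' = is_part s.
Proof.
rewrite /is_part; congr andb.
  rewrite !sorted_geq_blocks //; congr andb.
    by rewrite sorted_map; apply: eq_sorted => x y /=; lia.
  by rewrite /= path_sortedE; [rewrite (sub_all _ bm) // => k /=; lia
                              | move=> y x z /=; lia].
rewrite !mem_cat !inE !negb_or !mem_nseq.
have -> : 0 \notin a by apply/negP => /(allP am).
have -> : 0 \notin [seq m + k | k <- a] by apply/negP => /(allP am2).
by lia.
Qed.

(** The shift of [a] adds [size a * m], and [f] copies of [m] give way to a weight of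
    [(2 * t + 1) * m]; by [fE] the balance is [- m * h]. *)
Lemma sumn_double_blocks : ((sumn s')%:Z = (sumn s)%:Z - m%:Z * h)%R.
Proof.
rewrite !sumn_cat /= !sumn_nseq sumn_addn.
have -> : (h = f%:Z - (t%:Z *+ 2 + 1 + (size a)%:Z))%R by lia.
nia.
Qed.

(** There are [size a + t] parts of size at least [2 * m], and [fE] reads f - t = (size a + t) + h +
    1. *)
Lemma gap_part_double_blocks : gap_part s' = (t < f).
Proof.
rewrite /gap_part {1}s'E count_mem_blocks // eqxx count_geq_blocks // size_map.
have -> : all (fun k => ~~ (m + 1 <= k <= 2 * m - 1)) s'.
  rewrite !all_cat /=; apply/and4P; split; last 2 [lia].
  - by apply: sub_all am2 => k /=; lia.
  - by apply/allP => k /nseqP[-> _]; lia.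
  - by apply: sub_all bm => k /=; lia.
lia.
Qed.

(** The relation determines [t] from [f], [size a] and [h], so at most one row can carry the
    hook. *)
Lemma fixed_hook_double_blocks : has_fixed_hook_from h m m s = (t < f).
Proof.
apply/fixed_hook_blocksP/idP => // [[u uf ufE]|tf]; last by exists t.
by have -> : t = u by lia.
Qed.

End Canonical.

(** * Mutual inverses between the two classes of partitions *)

Lemma double_aboveP s : is_part s -> has_fixed_hook_from h m m s ->
  [/\ is_part (double_above s),
      ((sumn (double_above s))%:Z = (sumn s)%:Z - m%:Z * h)%R,
      gap_part (double_above s) & halve_above (double_above s) = s].
Proof.
move=> s_part; have /andP[s_sorted _] := s_part.
move: s_part; rewrite (sorted_geq_split m s_sorted).
set a := [seq k <- s | _]; set b := [seq k <- s | _]; set f := count_mem m s.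
have am : all (ltn m) a by apply: filter_all.
have bm : all (gtn m) b by apply: filter_all.
move=> s_part /(fixed_hook_blocksP _ am bm)[//|t tf fE].
rewrite (double_above_blocks am bm fE); split.
- by rewrite (is_part_double_blocks am bm fE).
- exact: sumn_double_blocks.
- by rewrite (gap_part_double_blocks am bm fE).
- exact: halve_above_blocks.
Qed.

Lemma halve_aboveP s : is_part s -> gap_part s ->
  [/\ is_part (halve_above s),
      ((sumn (halve_above s))%:Z = (sumn s)%:Z + m%:Z * h)%R,
      has_fixed_hook_from h m m (halve_above s)
    & double_above (halve_above s) = s].
Proof.
move=> s_part s_gap; have /andP[s_sorted _] := s_part.
have /and3P[/eqP m1 /allP no_mid hG] := s_gap.
pose a := [seq k - m | k <- s & 2 * m < k]; pose b := [seq k <- s | k < m].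
pose t := count_mem (2 * m) s.
have am : all (ltn m) a.
  by rewrite all_map; apply/allP => k; rewrite mem_filter /= => /andP[]; lia.
have bm : all (gtn m) b by apply: filter_all.
(* Split [s] at [2 * m], where [k - m] is a true subtraction, then split what lies below at [m]: the
   gap leaves nothing above [m], and [m] occurs once. *)
have sE : s = [seq m + k | k <- a] ++ nseq t (2 * m) ++ m :: b.
  rewrite {1}(sorted_geq_split (2 * m) s_sorted) -map_comp map_id_in; last first.
    by move=> k; rewrite mem_filter /= => /andP[]; lia.
  do 2!congr (_ ++ _).
  have geq_tr : transitive geq by move=> y x z /=; lia.
  rewrite {1}(sorted_geq_split m (sorted_filter geq_tr _ s_sorted)) -!filter_predI.
  rewrite (eq_in_filter (a2 := pred0)) ?filter_pred0; last first.
    by move=> k /no_mid /=; lia.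
  rewrite count_filter (eq_count (a2 := pred1 m)) ?m1 /=; last first.
    by move=> k /=; lia.
  by congr cons; apply: eq_filter => k /=; lia.
(* The gap condition gives [size a + t + h >= 0], so this future multiplicity of [m] is a natural
   number. *)
have ge0 : (0 <= t%:Z *+ 2 + 1 + (size a)%:Z + h)%R.
  move: hG; rewrite {1}sE count_geq_blocks ?size_map; first by lia.
    by rewrite all_map; apply: sub_all am => k /=; lia.
  by rewrite /=; apply/andP; split; [lia | apply: sub_all bm => k /=; lia].
have fE := gez0_abs ge0; move: (absz _) fE => f fE.
rewrite {}sE in s_part s_gap *.
rewrite (halve_above_blocks am bm fE); split.
- by rewrite -(is_part_double_blocks am bm fE).
- by rewrite (sumn_double_blocks am bm fE); lia.
- by rewrite (fixed_hook_double_blocks am bm fE) -(gap_part_double_blocks am bm fE).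
- exact: double_above_blocks.
Qed.

End Bijection.

Theorem theorem1p3 (m n : nat) (h : int) (hm : 1 <= m) :
  #|[set p : intpart n%:Z | has_fixed_hook_from h m m p]| =
  #|[set p : intpart (n%:Z - m%:Z * h)%R |
      [&& count_mem m p == 1,
          all (fun k => ~~ (m + 1 <= k <= 2 * m - 1)) p
        & (- h <= (count (leq (2 * m)) p)%:Z)%R]]|.
Proof.
(* Each map, with the other as left inverse, gives one inequality. *)
apply/eqP; rewrite eqn_leq; apply/andP; split.
  apply: (@leq_card_intpart _ _ (has_fixed_hook_from h m m) (gap_part m h)
            (double_above m h) (halve_above m h)) => s s_part sN s_hook.
  by have [? sumE ? ?] := double_aboveP hm s_part s_hook; rewrite sumE sN.
apply: (@leq_card_intpart _ _ (gap_part m h) (has_fixed_hook_from h m m)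
          (halve_above m h) (double_above m h)) => s s_part sN s_gap.
have [? sumE ? ?] := halve_aboveP hm s_part s_gap.
by rewrite sumE sN subrK.
Qed.
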